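(* Let $c \geq 4$ and let $G_1, G_2, \ldots, G_c$ be directed graphs on a common set of $n$ vertices. If $\sum_{i = 1}^c e(G_i) > \frac{c}{2}n^2$, then there exists a rainbow directed triangle.
   Context: A directed graph $G$ consists of a vertex set $V(G)$ and an edge set $E(G)$ of ordered pairs of distinct vertices (no loops, no multiple edges; both $(u,v)$ and $(v,u)$ may be present). $e(G)=|E(G)|$. The edges of $G_i$ are thought of as having color $i$. A rainbow directed triangle is a triple of distinct vertices $u,v,w$ together with pairwise distinct colors $a,b,d$ such that $(u,v)\in E(G_a)$, $(v,w)\in E(G_b)$, $(w,u)\in E(G_d)$. *)

(* Defs.v *)
From mathcomp Require Import all_boot all_order all_algebra.
Set Implicit Arguments.
Unset Strict Implicit.
Unset Printing Implicit Defensive.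

(* Loops and multiple edges are excluded; antiparallel edges are allowed. *)
Record digraph (V : finType) := Digraph {
  adj :> rel V;
  adj_irr : irreflexive adj
}.

Definition edges (V : finType) (G : digraph V) : {set V * V} :=
  [set p | G p.1 p.2].

Definition has_rainbow_triangle (V : finType) (c : nat)
    (G : 'I_c -> digraph V) : Prop :=
  exists (u v w : V) (a b d : 'I_c),
    [/\ uniq [:: u; v; w], uniq [:: a; b; d]
      & [/\ (u, v) \in edges (G a), (v, w) \in edges (G b)
          & (w, u) \in edges (G d)]].

(* Main.v *)
(** Choose four colours cyclically consecutive; averaging over the [c] choices
    reduces to [c = 4], where the bound is [2 n ^ 2].  Let [f u v <= 4] be the
    number of colours of the arc [(u, v)].  By greedy choice, no directed
    triangle has its three arcs carrying at least 1, 2 and 3 colours in some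
    order, and this is all that is used.  Argue by induction on the vertex set.

    If [f u v, f v u >= 2] for some [u, v], every other vertex sends total
    weight at most 8 to [{u, v}], and both vertices can be removed.  Otherwise
    a pair has total weight above 4 only if it is heavy: weight 4 one way, 1
    the other way.  If [d] is the largest heavy in- or outdegree, say the
    indegree of [v], then two heavy in-neighbours of [v] have total weight at
    most 2 between them.  So a heavy in-neighbour of [v] loses 2 against each of
    [d - 1] others and gains 1 on at most [2 d] heavy pairs: its degree is at
    most [4 (n - 1) + 2], and it can be removed. *)
Require Import Defs.
From mathcomp Require Import all_boot all_order all_algebra.
From mathcomp Require Import zify.
Import GRing.Theory Num.Theory.
Local Open Scope ring_scope.

Section Weights.
Set Implicit Arguments.
Unset Strict Implicit.
Local Open Scope nat_scope.

Lemma sum_nat_of_bool (T : finType) (S : {set T}) (P : pred T) :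
  \sum_(y in S) (P y : nat) = #|[set y in S | P y]|.
Proof. by rewrite -sum1dep_card big_mkcondr; apply: eq_bigr => y _; case: (P y). Qed.

Lemma rainbow_choice (T : finType) (A B C : {set T}) :
  0 < #|A| -> 1 < #|B| -> 2 < #|C| ->
  exists a b d, [/\ a \in A, b \in B, d \in C & uniq [:: a; b; d]].
Proof.
move=> /card_gt0P[a aA] B2 C3.
have /card_gt0P[b] : 0 < #|B :\ a| by have := cardsD1 a B; lia.
rewrite !inE => /andP[ba bB].
have /card_gt0P[d] : 0 < #|C :\ a :\ b|.
  by have := cardsD1 a C; have := cardsD1 b (C :\ a); lia.
rewrite !inE => /and3P[db da dC].
by exists a, b, d; split; rewrite //= !inE negb_or eq_sym ba eq_sym da eq_sym db.
Qed.

Definition pair_weight (V : Type) (f : V -> V -> nat) (x y : V) := f x y + f y x.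

Definition weight_in (V : finType) (f : V -> V -> nat) (S : {set V}) :=
  \sum_(u in S) \sum_(v in S) f u v.

Definition degree_in (V : finType) (f : V -> V -> nat) (S : {set V}) (x : V) :=
  \sum_(y in S) pair_weight f x y.

Definition heavy (V : Type) (f : V -> V -> nat) (x y : V) :=
  (3 < f x y) && (0 < f y x).

Definition heavy_in (V : finType) (f : V -> V -> nat) (S : {set V}) (x : V) :=
  [set y in S | heavy f y x].

Definition heavy_out (V : finType) (f : V -> V -> nat) (S : {set V}) (x : V) :=
  [set y in S | heavy f x y].

Definition loopless (V : Type) (f : V -> V -> nat) := forall u, f u u = 0.

Definition no_triangle123 (V : Type) (f : V -> V -> nat) :=
  forall u v w, 0 < f u v -> 1 < f v w -> 2 < f w u -> False.

Definition no_triangle132 (V : Type) (f : V -> V -> nat) :=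
  forall u v w, 0 < f u v -> 2 < f v w -> 1 < f w u -> False.

Definition no_double_pair (V : finType) (f : V -> V -> nat) (S : {set V}) :=
  forall u v, u \in S -> v \in S -> 1 < f u v -> 1 < f v u -> False.

Lemma weight_inD1 (V : finType) (f : V -> V -> nat) (S : {set V}) (x : V) :
  loopless f -> x \in S ->
  weight_in f S = weight_in f (S :\ x) + degree_in f (S :\ x) x.
Proof.
move=> f0 xS; rewrite /weight_in /degree_in (big_setD1 x xS) /=.
rewrite (big_setD1 x xS) /= f0 add0n.
under [X in _ + X = _]eq_bigr => u _ do rewrite (big_setD1 x xS) /=.
by rewrite !big_split /=; lia.
Qed.

Lemma degree_inD1 (V : finType) (f : V -> V -> nat) (S : {set V}) (x y : V) :
  y \in S -> degree_in f S x = pair_weight f x y + degree_in f (S :\ y) x.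
Proof. by move=> yS; rewrite /degree_in (big_setD1 y yS). Qed.

Lemma degree_in_id (V : finType) (f : V -> V -> nat) (S : {set V}) (x : V) :
  loopless f -> x \in S -> degree_in f (S :\ x) x = degree_in f S x.
Proof. by move=> f0 xS; rewrite (degree_inD1 f x xS) /pair_weight f0. Qed.

Lemma light_in_neighbour (V : finType) (f : V -> V -> nat) (S : {set V}) (v w : V) :
  (forall u u', f u u' <= 4) -> loopless f ->
  no_triangle123 f -> no_triangle132 f -> no_double_pair f S ->
  v \in S -> w \in heavy_in f S v ->
  degree_in f S w + 2 + 2 * #|heavy_in f S v|
    <= 4 * #|S| + #|heavy_in f S w| + #|heavy_out f S w|.
Proof.
move=> f4 f0 H1 H2 nd vS; rewrite inE => /andP[wS /andP[wv vw]].
have E2 : \sum_(y in S) 2 * (y == w) = 2.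
  by rewrite (big_setD1 w wS) /= eqxx big1 // => y; rewrite !inE => /andP[/negPf->].
rewrite -{1}E2 /degree_in -!sum_nat_of_bool big_distrr /= -!big_split /=.
rewrite mulnC -sum_nat_const -!big_split /=; apply: leq_sum => y yS.
rewrite /pair_weight /heavy; case: eqVneq => [->|yw]; first by rewrite !f0; lia.
have := f4 w y; have := f4 y w; have := nd w y wS yS.
have := H1 v w y vw; have := H2 w y v; have := H1 v y w; have := H2 y w v.
have := H1 w v y; have := H2 v w y.
lia.
Qed.

Lemma light_vertex_of_indegree (V : finType) (f : V -> V -> nat) (S : {set V}) (v : V) :
  (forall u u', f u u' <= 4) -> loopless f ->
  no_triangle123 f -> no_triangle132 f -> no_double_pair f S -> v \in S ->
  0 < #|heavy_in f S v| ->
  (forall x, x \in S -> maxn #|heavy_in f S x| #|heavy_out f S x| <= #|heavy_in f S v|) ->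
  exists2 x, x \in S & degree_in f S x + 2 <= 4 * #|S|.
Proof.
move=> f4 f0 H1 H2 nd vS /card_gt0P[w wI] dmax.
have wS : w \in S by move: wI; rewrite inE => /andP[].
exists w => //; have := light_in_neighbour f4 f0 H1 H2 nd vS wI.
by have := dmax w wS; lia.
Qed.

Lemma light_vertex_of_no_heavy (V : finType) (f : V -> V -> nat) (S : {set V}) (v : V) :
  (forall u u', f u u' <= 4) -> loopless f -> no_double_pair f S -> v \in S ->
  #|heavy_in f S v| = 0 -> #|heavy_out f S v| = 0 ->
  degree_in f S v + 2 <= 4 * #|S|.
Proof.
move=> f4 f0 nd vS /cards0_eq I0 /cards0_eq O0.
rewrite -(degree_in_id f0 vS).
suff : degree_in f (S :\ v) v <= \sum_(y in S :\ v) 4.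
  by rewrite sum_nat_const; have := cardsD1 v S; rewrite vS; lia.
apply: leq_sum => y; rewrite !inE => /andP[_ yS]; rewrite /pair_weight.
have := in_set0 y; rewrite -{1}I0 inE yS /heavy /=.
have := in_set0 y; rewrite -{1}O0 inE yS /heavy /=.
by have := nd v y vS yS; have := f4 v y; have := f4 y v; lia.
Qed.

Lemma light_vertex (V : finType) (f : V -> V -> nat) (S : {set V}) (v : V) :
  (forall u u', f u u' <= 4) -> loopless f ->
  no_triangle123 f -> no_triangle132 f -> no_double_pair f S -> v \in S ->
  exists2 x, x \in S & degree_in f S x + 2 <= 4 * #|S|.
Proof.
move=> f4 f0 H1 H2 nd vS.
case: (@arg_maxnP _ v (mem S) (fun x => maxn #|heavy_in f S x| #|heavy_out f S x|) vS).
move=> {vS}v vS dmax.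
have [d0|dpos] := posnP (maxn #|heavy_in f S v| #|heavy_out f S v|).
  by exists v => //; apply: light_vertex_of_no_heavy => //; lia.
have [IO|OI] := leqP #|heavy_out f S v| #|heavy_in f S v|.
  apply: (light_vertex_of_indegree f4 f0 H1 H2 nd vS) => [|x xS].
    by lia.
  by rewrite -(maxn_idPl IO); apply: dmax.
pose g x y := f y x.
have gI x : #|heavy_in g S x| = #|heavy_out f S x| by [].
have gO x : #|heavy_out g S x| = #|heavy_in f S x| by [].
have [|||||||x xS|x xS dx] := @light_vertex_of_indegree _ g S v.
- by move=> *; apply: f4.
- by move=> u; apply: f0.
- by move=> a b c ab bc ca; apply: (H2 b a c).
- by move=> a b c ab bc ca; apply: (H1 b a c).
- by move=> a b aS bS ab ba; apply: (nd b a).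
- by [].
- by rewrite gI; lia.
- by rewrite gI gO maxnC -(maxn_idPr (ltnW OI)); apply: dmax.
exists x => //; suff -> : degree_in f S x = degree_in g S x by [].
by apply: eq_bigr => y _; rewrite /pair_weight addnC.
Qed.

Lemma weight_in_bound (V : finType) (f : V -> V -> nat) (S : {set V}) :
  (forall u v, f u v <= 4) -> loopless f ->
  no_triangle123 f -> no_triangle132 f ->
  weight_in f S <= 2 * #|S| ^ 2.
Proof.
move=> f4 f0 H1 H2; have [n] := ubnP #|S|; elim: n S => // n IHn S ltSn.
have [/exists_inP[u uS /exists_inP[v vS /andP[uv vu]]]|/exists_inPn nex] :=
  boolP [exists u in S, [exists v in S, (1 < f u v) && (1 < f v u)]].
- have vSu : v \in S :\ u.
    by rewrite !inE vS andbT; apply: contraTneq uv => ->; rewrite f0.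
  have cS := cardsD1 u S; have cSu := cardsD1 v (S :\ u).
  rewrite uS in cS; rewrite vSu in cSu.
  rewrite (weight_inD1 f0 uS) (weight_inD1 f0 vSu) (degree_inD1 f u vSu).
  have IH : weight_in f (S :\ u :\ v) <= 2 * #|S :\ u :\ v| ^ 2 by apply: IHn; lia.
  have out8 : degree_in f (S :\ u :\ v) u + degree_in f (S :\ u :\ v) v
              <= #|S :\ u :\ v| * 8.
    rewrite -big_split /= -sum_nat_const; apply: leq_sum => w _; rewrite /pair_weight.
    have := H1 w u v; have := H2 v w u; have := H1 w v u; have := H2 u w v.
    have := f4 u w; have := f4 w u; have := f4 v w; have := f4 w v.
    lia.
  by have := f4 u v; have := f4 v u; rewrite /pair_weight; nia.
have [->|[v vS]] := set_0Vmem S; first by rewrite /weight_in big_set0.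
have nd : no_double_pair f S.
  by move=> a b aS bS ab ba; case/exists_inP: (nex a aS); exists b => //; rewrite ab.
have [x xS dx] := light_vertex f4 f0 H1 H2 nd vS.
have cS := cardsD1 x S; rewrite xS in cS.
have IH : weight_in f (S :\ x) <= 2 * #|S :\ x| ^ 2 by apply: IHn; lia.
by rewrite (weight_inD1 f0 xS) (degree_in_id f0 xS); nia.
Qed.

Lemma card_edges (V : finType) (G : digraph V) :
  #|edges G| = \sum_(u : V) \sum_(v : V) (G u v : nat).
Proof.
rewrite /edges -sum1dep_card big_mkcond pair_bigA /=.
by apply: eq_bigr => p _; case: (G _ _).
Qed.

Lemma four_colours_bound (V : finType) (c : nat) (G : 'I_c -> digraph V) (h : 'I_4 -> 'I_c) :
  injective h -> ~ has_rainbow_triangle G ->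
  \sum_(k < 4) #|edges (G (h k))| <= 2 * #|V| ^ 2.
Proof.
move=> hI nR; pose L u v := [set k | G (h k) u v].
have LP u v w a b d :
    a \in L u v -> b \in L v w -> d \in L w u -> uniq [:: a; b; d] -> False.
  rewrite !inE => ha hb hd U; apply: nR; exists u, v, w, (h a), (h b), (h d).
  split; [|by rewrite -(map_inj_uniq hI) in U|by rewrite !inE].
  rewrite /= !inE negb_or !andbT; apply/andP; split; [apply/andP; split|].
  - by apply: contraTneq ha => ->; rewrite adj_irr.
  - by apply: contraTneq hd => ->; rewrite adj_irr.
  - by apply: contraTneq hb => ->; rewrite adj_irr.
have -> : \sum_(k < 4) #|edges (G (h k))| = weight_in (fun u v => #|L u v|) setT.
  under eq_bigr do rewrite card_edges.
  rewrite exchange_big; apply: eq_big => [u|u _]; first by rewrite inE.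
  rewrite exchange_big; apply: eq_big => [v|v _]; first by rewrite inE.
  by rewrite -sum1dep_card [RHS]big_mkcond; apply: eq_bigr => k _; case: (G _ _ _).
rewrite -cardsT; apply: weight_in_bound.
- by move=> u v; rewrite -[leqRHS]card_ord max_card.
- by move=> u; apply: eq_card0 => k; rewrite !inE adj_irr.
- move=> u v w A B C; have [a [b [d [? ? ? U]]]] := rainbow_choice A B C.
  exact: (@LP u v w a b d).
- move=> u v w A C B; have [a [b [d [? ? ? U]]]] := rainbow_choice A B C.
  apply: (@LP u v w a d b) => //; move: U.
  by rewrite /= !inE !negb_or (eq_sym d b) !andbT -!andbA => /and3P[-> -> ->].
Qed.

Lemma sum_edges_bound (V : finType) (c : nat) (G : 'I_c -> digraph V) :
  4 <= c -> ~ has_rainbow_triangle G ->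
  2 * \sum_(i < c) #|edges (G i)| <= c * #|V| ^ 2.
Proof.
case: c G => // c G c4 nR.
have shift_inj (i : 'I_c.+1) : injective (fun k : 'I_4 => (i + inZp k)%R : 'I_c.+1).
  move=> k l /GRing.addrI/(congr1 val) /=.
  by rewrite !modn_small ?(leq_trans (ltn_ord _)) //; apply: val_inj.
have shift_sum (k : 'I_4) :
    \sum_(i < c.+1) #|edges (G (i + inZp k)%R)| = \sum_(i < c.+1) #|edges (G i)|.
  by rewrite [RHS](reindex_inj (@GRing.addIr _ (inZp k))).
have : \sum_(i < c.+1) \sum_(k < 4) #|edges (G (i + inZp k)%R)|
       <= \sum_(i < c.+1) 2 * #|V| ^ 2.
  by apply: leq_sum => i _; apply: (four_colours_bound (@shift_inj i) nR).
rewrite exchange_big /=; under eq_bigr do rewrite shift_sum.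
by rewrite !sum_nat_const !card_ord (mulnCA c.+1) -[4]/(2 * 2) -mulnA leq_pmul2l.
Qed.

Lemma rainbow_triangle_decidable (V : finType) (c : nat) (G : 'I_c -> digraph V) :
  decidable (has_rainbow_triangle G).
Proof.
pose rainbow (t : V * V * V * ('I_c * 'I_c * 'I_c)) :=
  let: (u, v, w, (a, b, d)) := t in
  [&& uniq [:: u; v; w], uniq [:: a; b; d], (u, v) \in edges (G a),
      (v, w) \in edges (G b) & (w, u) \in edges (G d)].
apply: (@decP _ [exists t, rainbow t]); apply: (iffP existsP).
  by case=> [[[[u v] w] [[a b] d]] /and5P[*]]; exists u, v, w, a, b, d.
by case=> u [v [w [a [b [d [? ? [*]]]]]]]; exists (u, v, w, (a, b, d)); apply/and5P.
Qed.

End Weights.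

Theorem theorem5 (c n : nat) (V : finType) (G : 'I_c -> digraph V)
    (hc : (4 <= c)%N) (hn : #|V| = n)
    (hG : c%:R / 2%:R * n%:R ^+ 2 < \sum_(i < c) #|edges (G i)|%:R :> rat) :
  has_rainbow_triangle G.
Proof.
have [//|nR] := rainbow_triangle_decidable G.
have := sum_edges_bound hc nR; rewrite hn leqNgt => /negP[].
move: hG; rewrite mulrAC ltr_pdivrMr // -natr_sum -natrX -!natrM ltr_nat.
by rewrite (mulnC 2).
Qed.
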